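(* We have $\alpha_0(z)=e^z-(z+1)$. For every $k\ge1$ there are polynomials $p_m^{(k)}(z)\in\mathbb Q[z]$, $1\le m\le k$, such that \[ \alpha_k(z)=\frac{(k+1)^k}{(k+1)!}e^{(k+1)z}+e^z\sum_{m=1}^k(-1)^m p_m^{(k)}(z)\,e^{(k-m)z}, \] and each $p_m^{(k)}$ has degree exactly $2m$ and positive leading coefficient.
   Context: For $n\ge3$ and $k\ge0$, $a_{k,n}=\operatorname{rk}H^{2k}(\overline{\mathcal M}_{0,n},\mathbb Q)$ is the coefficient of $t^k$ in $P_n(t)$, where $P_3(t)=1$ and, for $n>3$, $P_n(t)=P_{n-1}(t)(1+t)+t\sum_{i=3}^{n-2}\binom{n-2}{i-1}P_i(t)P_{n+1-i}(t)$ (so that $[\overline{\mathcal M}_{0,n}]=P_n(\mathbb L)$ in the Grothendieck ring of varieties). Define the generating function $\alpha_k(z)=\sum_{n\ge3}a_{k,n}\frac{z^{n-1}}{(n-1)!}$. *)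

(* Defs.v *)
From HB Require Import structures.
From mathcomp Require Import all_boot all_order all_algebra.
Set Implicit Arguments. Unset Strict Implicit. Unset Printing Implicit Defensive.
Import Order.TTheory GRing.Theory Num.Theory.
Local Open Scope ring_scope.

(* Given s = [:: P_0; ...; P_(n-1)], compute P_n.
   Convention: P_0 = P_1 = P_2 = 0 (unused), P_3 = 1, and for n > 3
   P_n = P_(n-1) (1+t) + t * sum_(i=3)^(n-2) C(n-2,i-1) P_i P_(n+1-i). *)
Definition Pnext (n : nat) (s : seq {poly rat}) : {poly rat} :=
  if (n < 3)%N then 0
  else if n == 3%N then 1
  else s`_(n.-1) * (1 + 'X)
       + 'X * \sum_(3 <= i < n.-1) ('C(n - 2, i - 1))%:R *: (s`_i * s`_(n + 1 - i)).

Fixpoint Ptab (n : nat) : seq {poly rat} :=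
  match n with
  | 0 => [::]
  | n'.+1 => let s := Ptab n' in rcons s (Pnext n' s)
  end.

Definition P (n : nat) : {poly rat} := (Ptab n.+1)`_n.

Definition a (k n : nat) : rat := (P n)`_k.

(* Coefficient of z^N in alpha_k(z) = sum_(n>=3) a_{k,n} z^(n-1)/(n-1)! *)
Definition alpha_coef (k N : nat) : rat :=
  if (2 <= N)%N then a k N.+1 / (N`!)%:R else 0.

(* Coefficient of z^N in the formal power series p(z) * e^(c z). *)
Definition expcoef (c : rat) (p : {poly rat}) (N : nat) : rat :=
  \sum_(j < N.+1) p`_j * (c ^+ (N - j) / ((N - j)`!)%:R).

(* Main.v *)
Require Import Defs.
From HB Require Import structures.
From mathcomp Require Import all_boot all_order all_algebra.
From mathcomp Require Import ring zify.
Import Order.TTheory GRing.Theory Num.Theory.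
Local Open Scope ring_scope.

(** With psi = 1 + z + sum_k alpha_k t^k, the recursion for P_n is the equation
    (1 + t (1 + z) - t psi) psi' = psi, i.e.
      psi_0' = psi_0,
      psi_(k+1)' = psi_(k+1) - (1 + z) psi_k' + sum_(l <= k) psi_l psi_(k-l)'.
    Hence psi_k = F_k(z, e^z) for some F_k in Q[z][E], where the coefficient
    g_j of E^j in F_(k+1) solves g_j' + (j - 1) g_j = R_j. Give z weight 1 and E
    weight 2. Then F_k has weight at most 2 (k + 1): the term -(1 + z) psi_k'
    raises the weight by 1, the quadratic term by 2, and solving for g_j keeps
    the degree of R_j if j > 1 and raises it by 1 if j = 1, a case to which
    only -(1 + z) psi_k' contributes. The coefficient of z^(2(k+1-j)) E^j in F_k
    has sign (-1)^(k+1-j): by induction it is, for j > 1, a positive combination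
    of products of such coefficients of F_0, ..., F_(k-1), and for j = 1 it is
    -1/(2k) times that of F_(k-1). The coefficient d_k of E^(k+1) in F_k satisfies
    (k + 1) d_(k+1) = sum_l (k - l + 1) d_l d_(k-l), which is solved by
    (k + 1)^k / (k + 1)! thanks to Abel's binomial identity. *)

(** * Power series as coefficient sequences: product, derivative, exponentials *)

Definition conv (f g : nat -> rat) (N : nat) : rat :=
  \sum_(j < N.+1) f j * g (N - j)%N.

Definition dseq (f : nat -> rat) (N : nat) : rat := N.+1%:R * f N.+1.

Lemma conv_poly f g N M : (N < M)%N ->
  conv f g N = (\poly_(i < M) f i * \poly_(i < M) g i)`_N.
Proof.
move=> ltNM; rewrite coefM; apply: eq_bigr => j _.
by rewrite !coef_poly !(leq_ltn_trans _ ltNM) ?leq_subr // -ltnS.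
Qed.

(** The Leibniz rule is inherited from polynomials, since coefficient [N] of either side sees only
    the truncations below degree [N.+2]. *)
Lemma dseq_conv f g N :
  dseq (conv f g) N = conv (dseq f) g N + conv f (dseq g) N.
Proof.
have coefD' h i : (i <= N)%N -> (\poly_(i < N.+2) h i)^`()`_i = dseq h i.
  by move=> leiN; rewrite /dseq coef_deriv coef_poly !ltnS leiN mulr_natl.
have coefP h i : (i <= N)%N -> (\poly_(i < N.+2) h i)`_i = h i.
  by move=> leiN; rewrite coef_poly ltnS leqW.
rewrite /dseq (@conv_poly f g N.+1 N.+2) // mulr_natl -coef_deriv derivM coefD !coefM.
by congr (_ + _); apply: eq_bigr => j _; have := ltn_ord j; rewrite ltnS => lej;
   rewrite coefD' ?coefP ?leq_subr.
Qed.

Lemma expcoefE c p N :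
  expcoef c p N = conv (fun j => p`_j) (fun i => c ^+ i / (i`!)%:R) N.
Proof. by []. Qed.

Lemma eq_conv {f f' g g'} N : f =1 f' -> g =1 g' -> conv f g N = conv f' g' N.
Proof. by move=> eqf eqg; apply: eq_bigr => j _; rewrite eqf eqg. Qed.

Lemma expcoefD c p q N : expcoef c (p + q) N = expcoef c p N + expcoef c q N.
Proof. by rewrite -big_split; apply: eq_bigr => j _ /=; rewrite coefD mulrDl. Qed.

Lemma expcoefZ c b p N : expcoef c (b *: p) N = b * expcoef c p N.
Proof. by rewrite mulr_sumr; apply: eq_bigr => j _; rewrite coefZ mulrA. Qed.

Lemma expcoef0 c N : expcoef c 0 N = 0.
Proof. by rewrite -(scale0r (0 : {poly rat})) expcoefZ mul0r. Qed.

Lemma expcoef_at0 c p : expcoef c p 0 = p`_0.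
Proof. by rewrite /expcoef big_ord_recl big_ord0 addr0 subn0 fact0 expr0 mul1r invr1 mulr1. Qed.

Lemma dseq_expcoef c p N : dseq (expcoef c p) N = expcoef c (p^`() + c *: p) N.
Proof.
rewrite /dseq expcoefE -/(dseq _ N) dseq_conv expcoefD expcoefZ; congr (_ + _).
  by apply: eq_bigr => j _; rewrite /dseq coef_deriv mulr_natl.
rewrite expcoefE /conv mulr_sumr; apply: eq_bigr => j _.
rewrite /dseq factS natrM exprS.
have nz: (N - j).+1%:R != 0 :> rat by rewrite pnatr_eq0.
have nf: ((N - j)`!)%:R != 0 :> rat by rewrite pnatr_eq0 -lt0n fact_gt0.
by field; rewrite nf nat1r nz.
Qed.

(** Both sides have the same constant term, and the derivative of each is again of the same form; so
    coefficient [N.+1] reduces to coefficient [N] for other [p] and [q]. *)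
Lemma conv_expcoef c d p q N :
  conv (expcoef c p) (expcoef d q) N = expcoef (c + d) (p * q) N.
Proof.
elim: N p q => [|N IH] p q.
  rewrite expcoef_at0 /conv big_ord_recl big_ord0 addr0 !expcoef_at0.
  by rewrite coefM big_ord_recl big_ord0 addr0.
apply: (@mulfI _ N.+1%:R); first by rewrite pnatr_eq0.
rewrite -!/(dseq _ N) dseq_conv.
rewrite (eq_conv N (dseq_expcoef c p) (frefl _)) (eq_conv N (frefl _) (dseq_expcoef d q)).
rewrite !IH dseq_expcoef -expcoefD; congr expcoef.
by rewrite derivM mulrDl mulrDr scalerDl -!scalerAl -!scalerAr; ring.
Qed.

(** The equation f' = f + r computes each coefficient from the preceding one, so the value at 0
    determines the solution. *)
Lemma dseq_uniq (f g r : nat -> rat) :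
    f 0 = g 0 -> (forall N, dseq f N = f N + r N) ->
    (forall N, dseq g N = g N + r N) ->
  f =1 g.
Proof.
move=> fg0 Df Dg; elim=> // N IH.
apply: (@mulfI _ N.+1%:R); first by rewrite pnatr_eq0.
by rewrite -!/(dseq _ N) Df Dg IH.
Qed.

(** * Polynomials in z and e^z as power series *)

(* A polynomial in [E] over Q[z] stands for its value at E = e^z, and
   [ev F N] is the coefficient of z^N of that power series. *)
Definition ev (F : {poly {poly rat}}) (N : nat) : rat :=
  \sum_(j < size F) expcoef j%:R F`_j N.

Lemma ev_widen M (F : {poly {poly rat}}) N : (size F <= M)%N ->
  ev F N = \sum_(j < M) expcoef j%:R F`_j N.
Proof.
move=> leFM; rewrite /ev (big_ord_widen M (fun j => expcoef j%:R F`_j N)) // big_mkcond.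
by apply: eq_bigr => j _; case: ltnP => // lej; rewrite nth_default ?expcoef0.
Qed.

Lemma evD F G N : ev (F + G) N = ev F N + ev G N.
Proof.
pose M := maxn (size F) (size G).
rewrite !(@ev_widen M) ?leq_maxl ?leq_maxr ?size_polyD // -big_split.
by apply: eq_bigr => j _ /=; rewrite coefD expcoefD.
Qed.

Lemma ev0 N : ev 0 N = 0.
Proof. by rewrite /ev size_poly0 big_ord0. Qed.

Lemma ev_sum I (r : seq I) (F : I -> {poly {poly rat}}) N :
  ev (\sum_(i <- r) F i) N = \sum_(i <- r) ev (F i) N.
Proof. by apply: (big_morph (ev^~ N)) => [F1 F2|]; rewrite ?evD ?ev0. Qed.

Lemma evN F N : ev (- F) N = - ev F N.
Proof. by apply/eqP; rewrite -addr_eq0 -evD addNr ev0. Qed.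

Lemma evCXn p j N : ev (p%:P * 'X^j) N = expcoef j%:R p N.
Proof.
rewrite (@ev_widen j.+1); last first.
  by apply/leq_sizeP => i lti; rewrite coefCM coefXn gtn_eqF // mulr0.
rewrite big_ord_recr /= big1 => [|i _].
  by rewrite coefCM coefXn eqxx mulr1 add0r.
by rewrite coefCM coefXn ltn_eqF // mulr0 expcoef0.
Qed.

Lemma convDl f g h N : conv (fun i => f i + g i) h N = conv f h N + conv g h N.
Proof. by rewrite -big_split; apply: eq_bigr => j _ /=; rewrite mulrDl. Qed.
Lemma convDr f g h N : conv h (fun i => f i + g i) N = conv h f N + conv h g N.
Proof. by rewrite -big_split; apply: eq_bigr => j _ /=; rewrite mulrDr. Qed.

Lemma poly_CXn_ind (K : {poly {poly rat}} -> Prop) :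
    K 0 -> (forall F G, K F -> K G -> K (F + G)) ->
    (forall p j, K (p%:P * 'X^j)) -> forall F, K F.
Proof.
move=> K0 KD KX F; rewrite -[F]coefK poly_def.
by apply: big_ind => // i _; rewrite -mul_polyC.
Qed.

Lemma evM F G N : ev (F * G) N = conv (ev F) (ev G) N.
Proof.
move: F; apply: poly_CXn_ind => [|F1 F2 IH1 IH2|p i].
- by rewrite mul0r ev0 /conv big1 // => j _; rewrite ev0 mul0r.
- rewrite mulrDl evD IH1 IH2 -convDl; apply: eq_conv => // j; exact/esym/evD.
move: G; apply: poly_CXn_ind => [|G1 G2 IH1 IH2|q j].
- by rewrite mulr0 ev0 /conv big1 // => l _; rewrite ev0 mulr0.
- rewrite mulrDr evD IH1 IH2 -convDr; apply: eq_conv => // l; exact/esym/evD.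
rewrite (eq_conv N (evCXn p i) (evCXn q j)) conv_expcoef -natrD -evCXn.
by congr ev; rewrite polyCM exprD; ring.
Qed.

(* d/dz acting on Q[z][E], with dE/dz = E. *)
Definition dE (F : {poly {poly rat}}) : {poly {poly rat}} :=
  \poly_(j < size F) ((F`_j)^`() + j%:R *: F`_j).

Lemma coef_dE F j : (dE F)`_j = (F`_j)^`() + j%:R *: F`_j.
Proof.
rewrite coef_poly; case: ltnP => // lej.
by rewrite nth_default // derivC scaler0 addr0.
Qed.

Lemma ev_dE F N : ev (dE F) N = dseq (ev F) N.
Proof.
rewrite (@ev_widen (size F)) ?size_poly // /dseq /ev mulr_sumr.
by apply: eq_bigr => j _; rewrite coef_dE -dseq_expcoef.
Qed.

(** * Abel's identity and the coefficients of the tree function *)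

(** An n-th finite difference kills powers below n: Pascal's rule turns the sum into one over the
    differences (i+1)^m - i^m, which involve only powers below m. *)
Lemma alternating_bin_sum_expn n m : (m < n)%N ->
  \sum_(i < n.+1) (-1) ^+ i * 'C(n, i)%:R * i%:R ^+ m = 0 :> rat.
Proof.
elim: n m => // n IH m ltmn.
rewrite big_ord_recl /= bin0 expr0 !mul1r.
under eq_bigr => i _ do rewrite /bump /= add1n binS natrD mulrDr mulrDl.
rewrite big_split /= addrA big_ord_recr /= bin_small // mulr0 mul0r addr0.
set S0 := (X in X + _); set S1 := (X in _ + X).
have -> : S0 = \sum_(i < n.+1) (-1) ^+ i * 'C(n, i)%:R * i%:R ^+ m.
  rewrite [RHS]big_ord_recl /= bin0 expr0 !mul1r; congr (_ + _).
rewrite -big_split /= (eq_bigr (fun i : 'I_n.+1 => - \sum_(l < m)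
   'C(m, l)%:R * ((-1) ^+ i * 'C(n, i)%:R * i%:R ^+ l))); last first.
  move=> i _; rewrite exprS mulN1r !mulNr -mulrBr -opprB mulrN.
  rewrite -[i.+1%:R]nat1r exprDn big_ord_recr /= subnn binn mulr1n expr1n mul1r addrK
    mulr_sumr; congr (- _).
  by apply: eq_bigr => l _; rewrite expr1n mul1r -mulr_natl; ring.
rewrite sumrN exchange_big /= big1 ?oppr0 // => l _.
by rewrite -mulr_sumr IH ?mulr0 // (leq_trans (ltn_ord l)).
Qed.

(** Induction on [n] by differentiation: the derivative of the identity is a multiple of the
    preceding one. The constant terms agree because the value at 0 is, up to sign, an alternating
    binomial sum of powers a^(n-1). *)
Lemma abel_poly n : (0 < n)%N ->
  \sum_(1 <= a < n.+1) ('C(n, a) * a ^ a.-1)%:R *: ('X - a%:R%:P) ^+ (n - a)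
    = n%:R *: 'X^(n.-1) :> {poly rat}.
Proof.
case: n => // n _; elim: n => [|n IH].
  by rewrite big_nat1 binn !scale1r subnn.
set Q := (X in X = _).
have dQ : Q^`() = n.+2%:R *: (n.+1%:R *: 'X^n).
  rewrite -IH /Q raddf_sum big_nat_recr //= subnn expr0 derivZ derivC scaler0 addr0.
  rewrite scaler_sumr; apply: eq_big_nat => a /andP[a1 lea].
  rewrite derivZ deriv_exp derivB derivX derivC subr0 mul1r -scaler_nat !scalerA -!natrM.
  rewrite subSn //=; congr (_%:R *: _).
  rewrite mulnAC -[(n.+1 - a).+1]subSn // [RHS]mulnA; congr (_ * _)%N.
  by rewrite mulnC -mul_bin_down.
have Q0 : Q`_0 = 0.
  rewrite -horner_coef0 /Q horner_sum.
  have := @alternating_bin_sum_expn n.+2 n.+1 (leqnn _).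
  rewrite -(big_mkord xpredT (fun i => (-1) ^+ i * 'C(n.+2, i)%:R * i%:R ^+ n.+1)).
  rewrite big_nat_recl //= expr0n /= mulr0 add0r.
  move=> E; rewrite -[RHS](mulr0 ((-1) ^+ n)) -[X in _ = _ * X]E {E}.
  rewrite mulr_sumr big_add1; apply: eq_big_nat => a /= lea.
  rewrite hornerZ horner_exp hornerXsubC sub0r subSS [in LHS]exprNn natrM natrX.
  rewrite ltnS in lea; have -> : (-1) ^+ n = (-1) ^+ (n.+1 - a) * (-1) ^+ a.+1 :> rat.
    by rewrite -exprD addnS subnK // -[n.+2]addn2 exprD expr2 mulrNN !mulr1.
  rewrite -[in X in _ = _ * (_ * X)](subnK lea) exprD.
  have := sqrr_sign rat a.+1; rewrite expr2 => s2.
  by rewrite -[LHS]mul1r -[X in X * _ = _]s2 /=; ring.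
apply/polyP => -[|i]; first by rewrite Q0 coefZ coefXn mulr0.
apply: (@mulIf _ i.+1%:R); first by rewrite pnatr_eq0.
rewrite !mulr_natr -!coef_deriv dQ derivZ derivXn -scaler_nat /=.
by [].
Qed.

(** The coefficient of x^(k+1) in the tree function T = x e^T. *)
Definition dcoef (k : nat) : rat := (k.+1 ^ k)%:R / (k.+1`!)%:R.

(** This is [abel_poly] for n = k + 2 evaluated at X = n, where (X - a)^(n-a) becomes (n - a)^(n-a);
    the term a = n moves to the other side and turns n^n into (k + 1) n^(n-1). *)
Lemma dcoef_rec k :
  k.+1%:R * dcoef k.+1 = \sum_(l < k.+1) dcoef l * ((k - l).+1%:R * dcoef (k - l)).
Proof.
have := congr1 (fun p => p.[k.+2%:R]) (@abel_poly k.+2 isT).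
rewrite big_nat_recr //= hornerD horner_sum subnn expr0 binn mul1n.
rewrite big_add1 big_mkord /= !hornerZ hornerXn hornerC mulr1 -!natrX -natrM => E.
have nf n : (n`!)%:R != 0 :> rat by rewrite pnatr_eq0 -lt0n fact_gt0.
apply: (@mulfI _ (k.+2`!)%:R) => //.
rewrite /dcoef mulrCA [_ / _]mulrC mulVKf // mulr_sumr.
have -> : k.+1%:R * (k.+2 ^ k.+1)%:R = (k.+2 * k.+2 ^ k.+1)%:R - (k.+2 ^ k.+1)%:R :> rat.
  by rewrite natrM -[k.+2%:R in RHS]natr1; ring.
rewrite -E addrK; apply: eq_bigr => l _.
have lel : (l <= k)%N by rewrite -ltnS.
rewrite hornerZ horner_exp hornerXsubC -natrB ?ltnS ?leqW //.
rewrite !subSS subSn // -(bin_fact (n := k.+2) (m := l.+1)) ?ltnS ?leqW //.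
rewrite !subSS subSn //; have := (nf l.+1, nf (k - l).+1).
rewrite [in LHS]natrM 2!natrM !natrX [in LHS]exprS.
move: (_`!)%:R (_`!)%:R => u v [nu nv].
by field; rewrite nu nv.
Qed.

(** * The recursion for P_n as a differential equation *)

Lemma size_Ptab n : size (Ptab n) = n.
Proof. by elim: n => //= n IH; rewrite size_rcons IH. Qed.

Lemma nth_Ptab n i : (i < n)%N -> (Ptab n)`_i = P i.
Proof.
elim: n => // n IH; rewrite ltnS leq_eqVlt => /orP[/eqP -> //|ltin].
by rewrite /= nth_rcons size_Ptab ltin IH.
Qed.

Lemma PE n : P n = Pnext n (Ptab n).
Proof. by rewrite /P /= nth_rcons size_Ptab ltnn eqxx. Qed.

Lemma P3 : P 3 = 1. Proof. by rewrite PE. Qed.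

Lemma P_rec n : (3 < n)%N ->
  P n = P n.-1 * (1 + 'X)
        + 'X * \sum_(3 <= i < n.-1) 'C(n - 2, i - 1)%:R *: (P i * P (n + 1 - i)).
Proof.
move=> lt3n; rewrite PE /Pnext ltnNge (ltnW lt3n) /= gtn_eqF // nth_Ptab ?prednK //; last by lia.
congr (_ + 'X * _); apply: eq_big_nat => i /andP[le3i lti].
by rewrite !nth_Ptab //; lia.
Qed.

(* [Psi N] is the coefficient of z^N in 1 + z + sum_k alpha_k(z) t^k. *)
Definition Psi (N : nat) : {poly rat} :=
  if (N < 2)%N then 1 else (N`!)%:R^-1 *: P N.+1.

Lemma Psi_rec N :
  N.+1%:R *: Psi N.+1 = Psi N - 'X * (N.+1%:R *: Psi N.+1 + N%:R *: Psi N)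
    + 'X * \sum_(i < N.+1) Psi i * ((N - i).+1%:R *: Psi (N - i).+1).
Proof.
case: N => [|[|N]].
- by rewrite big_ord_recl big_ord0 /Psi /= !scale1r scale0r mulr1; ring.
- rewrite !big_ord_recl big_ord0 /Psi /= P3 !mul1r !scale1r addr0 subn0 !scalerA
    !divff // !scale1r; ring.
have nzf n : (n`!)%:R != 0 :> rat by rewrite pnatr_eq0 -lt0n fact_gt0.
(* The summands i = 0 and i = 1 cancel the two subtracted terms; the last one, where [Psi 1 = 1],
   supplies the ['X] of the factor [1 + 'X]. *)
rewrite big_ord_recl big_ord_recl big_ord_recr /=.
rewrite /bump /= !add1n subn0 subSS subn0 !subSS subnn.
have -> : Psi 0 = 1 by []. have -> : Psi 1 = 1 by [].
rewrite !mul1r scale1r mulr1.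
suff -> : N.+3%:R *: Psi N.+3 = Psi N.+2 * (1 + 'X) +
    'X * \sum_(i < N) Psi (i.+2) * ((N - i).+1%:R *: Psi (N - i).+1).
  rewrite (eq_bigr (fun i : 'I_N => Psi i.+2 * ((N - i).+1%:R *: Psi (N - i).+1))); first by ring.
  by [].
rewrite /Psi /= scalerA P_rec //.
have -> : N.+3%:R / (N.+3)`!%:R = (N.+2)`!%:R^-1 :> rat.
  by rewrite factS natrM invfM mulVKf // pnatr_eq0.
rewrite scalerDr scalerAl; congr (_ + _).
rewrite scalerAr; congr ('X * _).
rewrite !big_add1 !succnK big_mkord scaler_sumr; apply: eq_bigr => i _.
have := ltn_ord i; move: (val i) => {}i lti.
rewrite ifF; last by lia.
have -> : (N.+4 + 1 - i.+3 = (N - i).+2)%N by lia.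
rewrite !subSS !subn0.
rewrite -scalerAl -!scalerAr !scalerA; congr (_ *: _).
have le2 : (i.+2 <= N.+2)%N by rewrite !ltnS ltnW.
have nb : 'C(N.+2, i.+2)%:R != 0 :> rat by rewrite pnatr_eq0 -lt0n bin_gt0.
have nm : (N - i).+1%:R != 0 :> rat by rewrite pnatr_eq0.
rewrite -(bin_fact le2) !subSS [((N - i).+1)`!]factS.
have := (nzf (i.+2), nzf (N - i)%N); move: ((i.+2)`!) ((N - i)`!) => u' v'.
rewrite !natrM; move: u'%:R v'%:R nb nm => u v nb nm [nu nv].
move: ('C(_, _)%:R) ((N - i).+1%:R) nb nm => b m nb nm.
by field; rewrite nu nv nb nm.
Qed.

Definition psi (k N : nat) : rat := (Psi N)`_k.

Lemma dseq_psi0 N : dseq (psi 0) N = psi 0 N.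
Proof.
have := congr1 (fun p : {poly rat} => p`_0) (Psi_rec N).
by rewrite /= !coefD coefN !coefXM coefZ oppr0 !addr0.
Qed.

Lemma dseq_psiS k N :
  dseq (psi k.+1) N = psi k.+1 N - (dseq (psi k) N + N%:R * psi k N)
    + \sum_(l < k.+1) conv (psi l) (dseq (psi (k - l))) N.
Proof.
have := congr1 (fun p : {poly rat} => p`_k.+1) (Psi_rec N).
rewrite /= !coefD coefN !coefXM /= coefD !coefZ coef_sum => E.
rewrite [LHS]E; congr (_ + _); rewrite exchange_big; apply: eq_bigr => i _ /=.
by rewrite coefM; apply: eq_bigr => l _; rewrite coefZ.
Qed.

Lemma psi_at0 k : psi k 0 = (k == 0)%:R.
Proof. by rewrite /psi /Psi coef1. Qed.

Lemma alpha_coef_psi k N :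
  alpha_coef k N = psi k N - (k == 0)%:R * (1 + 'X : {poly rat})`_N.
Proof.
rewrite /alpha_coef /psi /Psi /a ltnNge ltnS coefD coefX coef1.
case: N => [|[|N]]; rewrite /= ?coef1 ?coefZ ?addr0 ?add0r ?mulr0 ?subr0 ?mulr1 ?subrr //.
by rewrite mulrC.
Qed.

Lemma ev_Xmul F N : ev ('X%:P * dE F) N = N%:R * ev F N.
Proof.
rewrite evM; have evX i : ev 'X%:P i = (i == 1)%:R.
  rewrite -[_%:P]mulr1 -(expr0 'X) evCXn; case: i => [|i].
    by rewrite expcoef_at0 coefX.
  have := dseq_expcoef 0%:R ('X : {poly rat}) i.
  rewrite scale0r addr0 derivX /dseq => E.
  apply: (@mulfI _ i.+1%:R); first by rewrite pnatr_eq0.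
  rewrite E; case: i {E} => [|i]; first by rewrite expcoef_at0 coef1 mulr1.
  apply: (@mulfI _ i.+1%:R); first by rewrite pnatr_eq0.
  rewrite -/(dseq _ i) dseq_expcoef scale0r addr0 -polyC1 derivC expcoef0.
  by rewrite /= !mulr0.
case: N => [|N].
  by rewrite /conv big_ord_recl big_ord0 evX !mul0r addr0.
rewrite /conv !big_ord_recl big1 => [|i _]; last by rewrite evX mul0r.
by rewrite !evX mul0r add0r addr0 mul1r subSS subn0 ev_dE.
Qed.

(** * Weights and top-weight coefficients *)

(* The weights are 1 for z and 2 for [E]; [top n F j] is the coefficient of the
   monomial of weight n in E^j (meaningful when 2j <= n, as 2j is subtracted
   with truncation). *)
Definition weight_le (n : nat) (F : {poly {poly rat}}) : Prop :=
  forall j r, (n < r + j.*2)%N -> F`_j`_r = 0.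

Definition top (n : nat) (F : {poly {poly rat}}) (j : nat) : rat :=
  F`_j`_(n - j.*2).

Lemma top_gt n F j : weight_le n F -> (n < j.*2)%N -> top n F j = 0.
Proof. by move=> wF ltnj; apply: wF; lia. Qed.

Lemma coef2M (F G : {poly {poly rat}}) j r : (F * G)`_j`_r =
  \sum_(i < j.+1) \sum_(s < r.+1) F`_i`_s * G`_(j - i)`_(r - s).
Proof. by rewrite coefM coef_sum; apply: eq_bigr => i _; rewrite coefM. Qed.

Lemma weight_leM n m F G :
  weight_le n F -> weight_le m G -> weight_le (n + m) (F * G).
Proof.
move=> wF wG j r ltw; rewrite coef2M big1 // => i _; rewrite big1 // => s _.
have [ltn|len] := ltnP n (s + i.*2); first by rewrite wF ?mul0r.
rewrite wG ?mulr0 //; have := ltn_ord i; have := ltn_ord s; lia.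
Qed.

Lemma topM n m F G j : weight_le n F -> weight_le m G -> (j.*2 <= n + m)%N ->
  top (n + m) (F * G) j = \sum_(i < j.+1) top n F i * top m G (j - i).
Proof.
move=> wF wG lej; rewrite /top coef2M; apply: eq_bigr => i _.
have lei : (i <= j)%N by rewrite -ltnS.
have [ltni|leni] := ltnP n i.*2.
  rewrite -/(top n F i) top_gt // mul0r big1 // => s _.
  by rewrite wF ?mul0r // ltn_addl.
have [ltmi|lemi] := ltnP m (j - i).*2.
  rewrite -/(top m G _) top_gt // mulr0 big1 // => s _.
  by rewrite wG ?mulr0 // ltn_addl.
(* Only s = n - 2i survives: a larger s makes the first factor overweight, a smaller one the
   second. *)
have lts : (n - i.*2 < (n + m - j.*2).+1)%N by lia.
rewrite (bigD1 (Ordinal lts)) //= big1 ?addr0 => [|s /eqP nes].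
  by congr (_ * _`_(_)); lia.
have {}nes : s != (n - i.*2)%N :> nat by apply/eqP => E; apply: nes; exact: val_inj.
have lts' := ltn_ord s.
have [ltn|len] := ltnP n (s + i.*2); first by rewrite wF ?mul0r.
by rewrite wG ?mulr0 //; lia.
Qed.

Lemma weight_leD n F G : weight_le n F -> weight_le n G -> weight_le n (F + G).
Proof. by move=> wF wG j r lt; rewrite !coefD wF // wG // addr0. Qed.

Lemma weight_leW m n F : (m <= n)%N -> weight_le m F -> weight_le n F.
Proof. by move=> lemn wF j r lt; apply: wF; apply: leq_ltn_trans lt. Qed.

Lemma weight_le_dE n F : weight_le n F -> weight_le n (dE F).
Proof.
move=> wF j r lt; rewrite coef_dE coefD coef_deriv coefZ !wF ?mulr0 ?mul0rn ?addr0 //.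
by rewrite addSn ltnW.
Qed.

(** Differentiating in z lowers the weight, so only the factor j from E^j reaches the top. *)
Lemma top_dE n F j : weight_le n F -> (j.*2 <= n)%N -> top n (dE F) j = j%:R * top n F j.
Proof.
move=> wF lej; rewrite /top coef_dE coefD coef_deriv coefZ wF ?mul0rn ?add0r //; lia.
Qed.

(** * Solving g' + c g = p in polynomials *)

Lemma size_deriv_leq (p : {poly rat}) : (size p^`() <= (size p).-1)%N.
Proof.
apply/leq_sizeP => i lei; rewrite coef_deriv nth_default ?mul0rn //.
by move: lei; case: (size p).
Qed.

(* The solution [sum_i (-1)^i p^(i) / c^(i+1)] of g' + c g = p, with n terms. *)
Fixpoint dsolve (n : nat) (c : rat) (p : {poly rat}) : {poly rat} :=
  if n is m.+1 then c^-1 *: (p - dsolve m c p^`()) else 0.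

Lemma dsolveP n (c : rat) (p : {poly rat}) : c != 0 -> (size p <= n)%N ->
  (dsolve n c p)^`() + c *: dsolve n c p = p.
Proof.
move=> c0; elim: n p => [|n IH] p /= lep.
  by move: lep; rewrite leqn0 size_poly_eq0 => /eqP ->; rewrite derivC scaler0 addr0.
have {}IH : (dsolve n c p^`())^`() + c *: dsolve n c p^`() = p^`().
  by apply: IH; rewrite (leq_trans (size_deriv_leq p)) // -subn1 leq_subLR.
rewrite derivZ derivB scalerA divff // scale1r.
have <- : dsolve n c p^`() = c^-1 *: (p^`() - (dsolve n c p^`())^`()).
  by rewrite -[X in _ *: (X - _)]IH addrAC subrr add0r scalerA mulVf // scale1r.
by rewrite addrC subrK.
Qed.

Lemma size_dsolve n (c : rat) (p : {poly rat}) m : (size p <= m)%N -> (size (dsolve n c p) <= m)%N.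
Proof.
elim: n p => [|n IH] p /= lep; first by rewrite size_poly0.
apply: leq_trans (size_scale_leq _ _) _; apply: leq_trans (size_polyD _ _) _.
by rewrite size_polyN geq_max lep IH // (leq_trans (size_deriv_leq p)) // (leq_trans (leq_pred _)).
Qed.

(** The equation splits into g_j' + (j - 1) g_j = R_j. An antiderivative is needed for j = 1; the
    vanishing coefficient of R_1 keeps its degree within the weight bound. *)
Lemma solve_dE n (R : {poly {poly rat}}) : (1 < n)%N ->
    R`_0 = 0 -> weight_le n.*2 R -> R`_1`_(n.*2 - 2) = 0 ->
  exists G, [/\ dE G = G + R, G`_0 = 0, weight_le n.*2 G & ev G 0 = 0].
Proof.
move=> lt1n R0 wR R1.
pose prim : {poly rat} := \poly_(i < n.*2.-1) (if i is r.+1 then R`_1`_r / r.+1%:R else 0).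
pose g (j : nat) : {poly rat} := if j == 0%N then 0 else if j == 1%N then prim
  else dsolve (size R`_j) j.-1%:R R`_j.
pose G0 : {poly {poly rat}} := \poly_(j < (size R).+2) g j.
have coefG0 j : G0`_j = g j.
  rewrite coef_poly; case: ltnP => //; rewrite /g; case: j => [|[|j]] //=.
  by rewrite !ltnS => lej; rewrite nth_default ?size_poly0 // leqW ?leqW.
have wR1 r : (n.*2 - 2 <= r)%N -> R`_1`_r = 0.
  rewrite leq_eqVlt => /orP[/eqP <- //|ltr]; apply: wR; lia.
(* E solves the homogeneous equation, so subtracting a constant multiple of it adjusts the value at
   z = 0. *)
pose G := G0 - (ev G0 0)%:P%:P * 'X^1.
have coefG j : G`_j = g j - (if j == 1%N then (ev G0 0)%:P else 0).
  by rewrite coefB coefG0 coefCM coefXn; case: eqP => _; rewrite ?mulr1 ?mulr0.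
exists G; split.
- apply/polyP => j; rewrite coef_dE coefD coefG /g.
  case: j => [|[|j]] /=; rewrite ?subr0.
  + by rewrite R0 derivC scaler0.
  + rewrite scale1r addrC; congr (_ + _); rewrite derivB derivC subr0.
    apply/polyP => r; rewrite coef_deriv coef_poly.
    case: ltnP => [ltr|ler]; last by rewrite mul0rn wR1 //; lia.
    by rewrite -[LHS]mulr_natr mulfVK // pnatr_eq0.
  + rewrite -[X in _ = _ + X](@dsolveP (size R`_j.+2) j.+1%:R) ?pnatr_eq0 //.
    by rewrite addrCA -[X in _ = _ + (X + _)]scale1r -scalerDl nat1r.
- by rewrite coefG /g /= subr0.
- move=> j r ltw; rewrite coefG /g; case: j ltw => [|[|j]] /= ltw; rewrite ?subr0 ?coef0 //.
  + rewrite coefB coef_poly coefC ifF ?ifF ?subr0 //; lia.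
  + have: (size (R`_j.+2)%R <= r)%N.
      by apply/leq_sizeP => s les; apply: wR; lia.
    by move=> /(@size_dsolve (size R`_j.+2) j.+1%:R) /leq_sizeP ->.
- by rewrite evD evN evCXn expcoef_at0 coefC subrr.
Qed.

(** * The induction on k *)

(** For j = k + 1 - m, [top k.+1.*2 F j] is the coefficient of z^(2m) in that of E^j, and the sign
    is (-1)^m: this encodes degree and positivity of p_m. *)
Definition alpha_shape (k : nat) (F : {poly {poly rat}}) : Prop :=
  [/\ psi k =1 ev F, F`_0 = 0, weight_le k.+1.*2 F,
      forall j, (0 < j <= k.+1)%N -> 0 < (-1) ^+ (k.+1 + j) * top k.+1.*2 F j
    & top k.+1.*2 F k.+1 = dcoef k].

Lemma alpha_shape0 : alpha_shape 0 'X.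
Proof.
have coefXX j : ('X : {poly {poly rat}})`_j = (j == 1)%:R by rewrite coefX.
have evX N : ev 'X N = expcoef 1 1 N by rewrite -['X]mul1r -[X in X * _]polyC1 -['X]expr1 evCXn.
split.
- apply: (@dseq_uniq _ _ (fun=> 0)) => [|N|N].
  + by rewrite psi_at0 evX expcoef_at0 coef1.
  + by rewrite addr0 dseq_psi0.
  + rewrite -ev_dE addr0; congr ev; apply/polyP => j; rewrite coef_dE coefXX.
    by case: j => [|[|j]]; rewrite /= -?polyC1 -?polyC0 derivC ?scaler0 ?scale1r ?add0r.
- by rewrite coefXX.
- move=> j r ltw; rewrite coefXX; case: eqP ltw => [->|_ _]; last by rewrite coef0.
  by case: r => // r _; rewrite coef1.
- by move=> [|[|j]] //= _; rewrite /top coefXX coef1 mulr1 expr2 mulrNN mulr1.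
- by rewrite /top coefXX coef1.
Qed.

Lemma alpha_shapeS k (F : nat -> {poly {poly rat}}) :
    (forall l, (l <= k)%N -> alpha_shape l (F l)) ->
  exists G, alpha_shape k.+1 G.
Proof.
move=> shF.
have F0 l : (l <= k)%N -> (F l)`_0 = 0 by move=> /shF[].
have wF l : (l <= k)%N -> weight_le l.+1.*2 (F l) by move=> /shF[].
have evF l : (l <= k)%N -> psi l =1 ev (F l) by move=> /shF[].
have wdF l : (l <= k)%N -> weight_le l.+1.*2 (dE (F l)).
  by move=> /wF; exact: weight_le_dE.
pose S := \sum_(l < k.+1) F l * dE (F (k - l)%N).
pose L := - ((1 + 'X)%:P * dE (F k)).
(* Both factors of each product are divisible by E, so [S] starts at E^2. *)
have Sj0 j : (j < 2)%N -> S`_j = 0.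
  move=> ltj; rewrite coef_sum big1 // => l _; have lel : (l <= k)%N by rewrite -ltnS.
  have dF0 : (dE (F (k - l)%N))`_0 = 0 by rewrite coef_dE F0 ?leq_subr // derivC scaler0 addr0.
  rewrite coefM big1 // => i _; have := ltn_ord i.
  case: (val i) => [|m] lti; first by rewrite F0 ?mul0r.
  have -> : (j - m.+1 = 0)%N by lia.
  by rewrite dF0 mulr0.
have coefL j r : L`_j`_r = - ((dE (F k))`_j`_r + (dE (F k))`_j`_r.-1 *+ (r != 0)).
  rewrite coefN coefCM coefN mulrDl mul1r coefD coefXM; congr (- (_ + _)).
  by case: r.
have wL : weight_le k.+1.*2.+1 L.
  move=> j r ltw; rewrite coefL !wdF // ?mul0rn ?addr0 ?oppr0 //; lia.
have wS : weight_le k.+2.*2 S.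
  move=> j r ltw; rewrite !coef_sum big1 // => l _; have lel : (l <= k)%N by rewrite -ltnS.
  apply: (@weight_leM l.+1.*2 (k - l).+1.*2); rewrite ?wF ?wdF ?leq_subr //; last by lia.
    exact: wF.
  by apply: wdF; rewrite leq_subr.
have L0 : L`_0 = 0 by rewrite coefN coefCM coef_dE F0 // derivC scaler0 addr0 mulr0 oppr0.
have wLS : weight_le k.+2.*2 (L + S).
  by apply: weight_leD => //; apply: weight_leW wL; lia.
have [||G [eqG G0 wG evG0]] := @solve_dE k.+2 (L + S) isT _ wLS.
- by rewrite coefD L0 Sj0 ?addr0.
- by rewrite coefD Sj0 // addr0 wL //; lia.
(* [L] has weight at most 2k + 3, one below the bound, so the top coefficients come from [S]
   alone. *)
have topG j : (0 < j <= k.+2)%N -> j.-1%:R * top k.+2.*2 G j = top k.+2.*2 S j.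
  case/andP=> j0 lej.
  have -> : top k.+2.*2 S j = top k.+2.*2 (L + S) j.
    by rewrite /top coefD coefD wL ?add0r //; lia.
  have : top k.+2.*2 (dE G) j = top k.+2.*2 G j + top k.+2.*2 (L + S) j.
    by rewrite eqG /top !coefD.
  rewrite top_dE //; last by lia.
  by rewrite -[j in j%:R](prednK j0) -natr1 mulrDl mul1r addrC => /addrI.
have topS j : (j <= k.+2)%N -> top k.+2.*2 S j =
    \sum_(l < k.+1) \sum_(i < j.+1) top l.+1.*2 (F l) i *
       ((j - i)%:R * top (k - l).+1.*2 (F (k - l)%N) (j - i)).
  move=> lej; rewrite {1}/top !coef_sum; apply: eq_bigr => l _.
  have lel : (l <= k)%N by rewrite -ltnS.
  have ew : (k.+2.*2 = l.+1.*2 + (k - l).+1.*2)%N by lia.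
  rewrite -/(top _ (F l * _) j) ew topM; last by rewrite -ew; lia.
  - apply: eq_bigr => i _; congr (_ * _).
    have [lt|le] := ltnP (k - l).+1.*2 (j - i).*2.
      by rewrite !top_gt ?mulr0 //; [apply: wF|apply: wdF]; rewrite leq_subr.
    by rewrite top_dE //; apply: wF; rewrite leq_subr.
  - exact: wF.
  - by apply: wdF; rewrite leq_subr.
have top0 l : (l <= k)%N -> top l.+1.*2 (F l) 0 = 0.
  by move=> lel; rewrite /top F0 // coef0.
have posF l j : (l <= k)%N -> (0 < j <= l.+1)%N ->
    0 < (-1) ^+ (l.+1 + j) * top l.+1.*2 (F l) j.
  by move=> /shF[_ _ _ posl _]; apply: posl.
have nonnegF l j : (l <= k)%N -> 0 <= (-1) ^+ (l.+1 + j) * top l.+1.*2 (F l) j.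
  move=> lel; case: j => [|j]; first by rewrite top0 ?mulr0.
  have [lej|ltj] := leqP j.+1 l.+1; first by rewrite ltW // posF.
  by rewrite top_gt ?mulr0 //; [exact: wF|lia].
exists G; split => //.
- apply: (@dseq_uniq _ _ (ev (L + S))) => [|N|N].
  + by rewrite psi_at0 evG0.
  + rewrite dseq_psiS -addrA evD; congr (_ + (_ + _)).
      rewrite evN polyCD mulrDl evD mul1r ev_Xmul ev_dE; congr (- (_ + _ * _)).
        by rewrite /dseq evF.
      exact: evF.
    rewrite ev_sum; apply: eq_bigr => l _; have lel : (l <= k)%N by rewrite -ltnS.
    rewrite evM; apply: eq_bigr => i _; rewrite evF // ev_dE /dseq evF //.
    by rewrite leq_subr.
  + by rewrite -ev_dE eqG evD.
- case=> [//|[_|j lej]].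
    (* At j = 1 [topG] reads 0 = 0. The coefficient of z^(2k+1) E is compared instead; on the right,
       besides that of [G], it receives only the one from -z psi_k'. *)
    have := congr1 (fun p : {poly {poly rat}} => p`_1`_(k.*2.+1)) eqG.
    rewrite coef_dE scale1r !coefD [S`_1]Sj0 // coef0 addr0 addrC => /addrI.
    rewrite coefL [X in X + _](wdF k) ?add0r //=; last by lia.
    have -> : (dE (F k))`_1`_(k.*2) = (F k)`_1`_(k.*2).
      by rewrite coef_dE scale1r coefD coef_deriv (wF k) ?mul0rn ?add0r //; lia.
    rewrite mulr1n coef_deriv -mulr_natl => eqG1.
    rewrite -(@pmulr_rgt0 _ k.*2.+2%:R) ?ltr0n // mulrCA {1}/top.
    have -> : (k.+2.*2 - 1.*2 = k.*2.+2)%N by lia.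
    have := posF k 1 (leqnn k) isT; rewrite /top.
    have -> : (k.+1.*2 - 1.*2 = k.*2)%N by lia.
    by rewrite eqG1 !addSn [in X in _ -> X]exprS mulN1r mulrNN.
  rewrite -(@pmulr_rgt0 _ j.+1%:R) ?ltr0n // mulrCA (topG j.+2) // topS // mulr_sumr.
  have signE l i : (l <= k)%N -> (i <= j.+2)%N -> (-1) ^+ (k.+2 + j.+2) =
      (-1) ^+ (l.+1 + i) * (-1) ^+ ((k - l).+1 + (j.+2 - i)) :> rat.
    by move=> lel lei; rewrite -exprD; congr (_ ^+ _); lia.
  have shuffle (u v x y z : rat) : u * v * (x * (y * z)) = y * ((u * x) * (v * z)).
    by ring.
  have term_ge0 (l : 'I_k.+1) (i : 'I_j.+3) : 0 <= (-1) ^+ (k.+2 + j.+2) * (top l.+1.*2 (F l) i *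
       ((j.+2 - i)%:R * top (k - l).+1.*2 (F (k - l)%N) (j.+2 - i))).
    have lel : (l <= k)%N by rewrite -ltnS.
    have lei : (i <= j.+2)%N by rewrite -ltnS.
    by rewrite (signE l i lel lei) shuffle mulr_ge0 ?ler0n // mulr_ge0 ?nonnegF ?leq_subr.
  (* No term is negative, so one positive term suffices: l = 0, i = 1, where [posF] applies to both
     top coefficients. *)
  rewrite big_ord_recl ltr_wpDr //.
    by apply: sumr_ge0 => l _; rewrite mulr_sumr sumr_ge0.
  rewrite mulr_sumr (bigD1 (Ordinal (isT : (1 < j.+3)%N))) //= ltr_wpDr //.
    by apply: sumr_ge0 => i _; exact: (term_ge0 ord0 i).
  rewrite (signE 0 1 (leq0n _) isT) shuffle subn0 mulr_gt0 ?ltr0n //.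
  by rewrite mulr_gt0 ?posF //; lia.
- have := topG k.+2; rewrite leqnn => /(_ isT) E.
  apply: (@mulfI _ k.+1%:R); first by rewrite pnatr_eq0.
  rewrite E dcoef_rec topS //; apply: eq_bigr => l _.
  have lel : (l <= k)%N by rewrite -ltnS.
  have ltl : (l.+1 < k.+3)%N by lia.
  have [_ _ _ _ Dl] := shF l lel; have [_ _ _ _ Dk] := shF (k - l)%N (leq_subr _ _).
  (* [F l] has E-degree at most l + 1, so i > l + 1 kills the first factor and i < l + 1 the
     second. *)
  rewrite (bigD1 (Ordinal ltl)) //= big1 ?addr0 => [|i /eqP nei].
    have -> : (k.+2 - l.+1 = (k - l).+1)%N by lia.
    by rewrite Dl Dk.
  have {}nei : nat_of_ord i != l.+1 by apply/eqP => e; apply: nei; exact: val_inj.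
  have [lt|] := ltnP l.+1 i; first by rewrite top_gt ?mul0r //; [exact: wF|lia].
  move=> lei; rewrite [X in _ * (_ * X)]top_gt ?mulr0 //; last by lia.
  by apply: wF; rewrite leq_subr.
Qed.

Lemma alpha_shape_exists k : exists F, alpha_shape k F.
Proof.
suff [F shF] : exists F : nat -> {poly {poly rat}}, forall l, (l <= k)%N -> alpha_shape l (F l).
  by exists (F k); exact: shF.
elim: k => [|k [F shF]].
  by exists (fun=> 'X) => l; rewrite leqn0 => /eqP ->; exact: alpha_shape0.
have [G shG] := @alpha_shapeS k F shF.
exists (fun l => if l == k.+1 then G else F l) => l; rewrite leq_eqVlt.
by case: eqP => [-> //|_] /= /shF.
Qed.

(** * Reading off the polynomials p_m *)

Theorem theorem4p1 :
  (forall N : nat, alpha_coef 0 N = expcoef 1 1 N - (1 + 'X : {poly rat})`_N) /\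
  (forall k : nat, (1 <= k)%N ->
    exists p : nat -> {poly rat},
      (forall N : nat,
         alpha_coef k N =
           ((k.+1 ^ k)%:R / (k.+1`!)%:R) * expcoef k.+1%:R 1 N
           + \sum_(1 <= m < k.+1) (-1) ^+ m * expcoef (k.+1 - m)%:R (p m) N) /\
      (forall m : nat, (1 <= m <= k)%N ->
         size (p m) = (2 * m).+1 /\ 0 < lead_coef (p m))).
Proof.
split=> [N|k k1].
  have [psiX _ _ _ _] := alpha_shape0.
  rewrite alpha_coef_psi mul1r psiX; congr (_ - _).
  by rewrite -['X]mul1r -[X in X * _]polyC1 -['X]expr1 evCXn.
have [F [psiF F0 wF posF lead]] := alpha_shape_exists k.
(* Since e^z e^((k-m)z) = e^((k+1-m)z), p_m is the coefficient of E^(k+1-m) up to the sign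
   (-1)^m. *)
exists (fun m => (-1) ^+ m *: F`_(k.+1 - m)); split=> [N|m /andP[m1 lemk]].
  have sF : (size F <= k.+2)%N.
    apply/leq_sizeP => j lej; apply/polyP => r; rewrite coef0 wF //; lia.
  rewrite alpha_coef_psi gtn_eqF // mul0r subr0 psiF (@ev_widen k.+2) //.
  rewrite big_ord_recr addrC /=; congr (_ + _); last first.
    (* E^(k+1) already has the maximal weight, so its coefficient is constant in z. *)
    have -> : F`_k.+1 = dcoef k *: 1.
      apply/polyP => -[|r]; rewrite coefZ coef1 /= ?mulr1 ?mulr0; last by rewrite wF //; lia.
      by rewrite -lead /top subnn.
    by rewrite expcoefZ.
  rewrite big_ord_recl F0 expcoef0 add0r big_add1 big_mkord.
  rewrite (reindex_inj rev_ord_inj); apply: eq_bigr => i _ /=.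
  rewrite expcoefZ mulrA -exprD addnn -mul2n exprM sqrrN !expr1n mul1r.
  by rewrite /bump /= add1n -subSn ?subSS //; have := ltn_ord i; lia.
have top_gt0 : 0 < ((-1) ^+ m *: F`_(k.+1 - m))`_(2 * m).
  have := posF (k.+1 - m)%N; rewrite /top coefZ.
  have -> : (k.+1.*2 - (k.+1 - m).*2 = 2 * m)%N by lia.
  have -> : (-1) ^+ (k.+1 + (k.+1 - m)) = (-1) ^+ m :> rat.
    by rewrite -signr_odd -[RHS]signr_odd; congr (_ ^+ nat_of_bool _); lia.
  by apply; lia.
have sp : size ((-1) ^+ m *: F`_(k.+1 - m)) = (2 * m).+1.
  apply/eqP; rewrite eqn_leq; apply/andP; split.
    by apply/leq_sizeP => r ler; rewrite coefZ wF ?mulr0 //; lia.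
  by rewrite ltnNge; apply/negP => /leq_sizeP /(_ _ (leqnn _)) E; rewrite E ltxx in top_gt0.
by split; rewrite // lead_coefE sp.
Qed.
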